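(* Let $C$ be a Reedy category, let $\Gamma$ be one of $\int N(C)$, $\int N^{-,+}(C)$, $\int N^{--,+}_+(C)$, and let $(\alpha,\theta)\colon([m],X)\to([n],Y)$ be a morphism in $\Gamma$. Then the upward interval $\{(\beta,\varphi)\in\mathrm{Hom}_\Gamma(([m],X),([n],Y)):(\alpha,\theta)\le(\beta,\varphi)\}$, with the induced order, is a bounded distributive lattice.
   Context: A Reedy category $(C,C_-,C_+)$: wide subcategories with unique factorization of every morphism as ($C_-$ then $C_+$), membership in $C_\pm$ decidable, and the relation ($x<'y$ iff non-identity $x\to y$ in $C_+$ or non-identity $y\to x$ in $C_-$) well-founded. $\Delta$: finite ordinals $[n]$ and order-preserving maps. $\int N(C)$: objects $([n],X)$ with $X\colon[n]\to C$ a functor; morphisms $([m],X)\to([n],Y)$ are $(\alpha,\theta)$, $\alpha\colon[m]\to[n]$ in $\Delta$, $\theta\colon X\Rightarrow Y\circ\alpha$; composition $(\beta,\varphi)\circ(\alpha,\theta)=(\beta\alpha,(\varphi\alpha)\circ\theta)$. $\int N^{-,+}(C)$: subcategory of objects with $X$ sending all morphisms into $C_-$ and morphisms with all $\theta_i\in C_+$. $\int N^{--,+}_+(C)$: its subcategory of objects whose $X$ reflects identities and morphisms with $\alpha$ injective. Order on hom-sets: $(\alpha,\theta)\le(\alpha',\theta')$ iff $\alpha\le\alpha'$ pointwise and $\theta'_i=Y(\alpha(i)\le\alpha'(i))\circ\theta_i$ for all $i$. *)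

(* Defs.v *)
From mathcomp Require Import all_boot.
Set Implicit Arguments. Unset Strict Implicit. Unset Printing Implicit Defensive.

Record Category := {
  Ob :> Type;
  Hom : Ob -> Ob -> Type;
  idm : forall a, Hom a a;
  comp : forall a b c, Hom b c -> Hom a b -> Hom a c;
  comp_id_l : forall a b (f : Hom a b), comp (idm b) f = f;
  comp_id_r : forall a b (f : Hom a b), comp f (idm a) = f;
  comp_assoc : forall a b c d (h : Hom c d) (g : Hom b c) (f : Hom a b),
      comp h (comp g f) = comp (comp h g) f
}.

Arguments Hom {c0} _ _.
Arguments idm {c0} a.
Arguments comp {c0 a b c} _ _.
Definition is_id (C : Category) (a b : C) (f : Hom a b) : Prop :=
  exists e : a = b, f = eq_rect a (fun x => Hom a x) (idm a) b e.

Record Reedy (C : Category) := {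
  minus : forall a b : C, Hom a b -> bool;
  plus  : forall a b : C, Hom a b -> bool;
  minus_id : forall a, minus (idm a);
  plus_id  : forall a, plus (idm a);
  minus_comp : forall a b c (g : Hom b c) (f : Hom a b),
      minus g -> minus f -> minus (comp g f);
  plus_comp : forall a b c (g : Hom b c) (f : Hom a b),
      plus g -> plus f -> plus (comp g f);
  fact_ex : forall a b (f : Hom a b),
      exists c (p : Hom a c) (q : Hom c b), [/\ minus p, plus q & comp q p = f];
  fact_uniq : forall a b c1 c2 (p1 : Hom a c1) (q1 : Hom c1 b)
      (p2 : Hom a c2) (q2 : Hom c2 b),
      minus p1 -> plus q1 -> minus p2 -> plus q2 -> comp q1 p1 = comp q2 p2 ->
      existT (fun c => (Hom a c * Hom c b)%type) c1 (p1, q1) =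
      existT (fun c => (Hom a c * Hom c b)%type) c2 (p2, q2);
  reedy_wf : well_founded (fun x y : C =>
      (exists f : Hom x y, plus f /\ ~ is_id f) \/
      (exists g : Hom y x, minus g /\ ~ is_id g))
}.

(* ---------- Functors [n] -> C (the nerve N(C)) ---------- *)
Record chain (C : Category) (n : nat) := {
  ob_at : 'I_n.+1 -> C;
  mor_at : forall i j : 'I_n.+1, (i <= j)%N -> Hom (ob_at i) (ob_at j);
  mor_at_id : forall (i : 'I_n.+1) (h : (i <= i)%N), mor_at h = idm (ob_at i);
  mor_at_comp : forall i j k : 'I_n.+1, forall (hij : (i <= j)%N) (hjk : (j <= k)%N) (hik : (i <= k)%N),
      mor_at hik = comp (mor_at hjk) (mor_at hij)
}.

(* Morphisms ([m],X) -> ([n],Y) of int N(C): pairs (alpha, theta) *)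
Definition pre_mor (C : Category) m n (X : chain C m) (Y : chain C n) :=
  { alpha : 'I_m.+1 -> 'I_n.+1 &
    forall i : 'I_m.+1, Hom (ob_at X i) (ob_at Y (alpha i)) }.

Definition is_mor (C : Category) m n (X : chain C m) (Y : chain C n)
    (p : pre_mor X Y) : Prop :=
  let alpha := projT1 p in let theta := projT2 p in
  (forall i j : 'I_m.+1, (i <= j)%N -> (alpha i <= alpha j)%N) /\
  forall (i j : 'I_m.+1) (h : (i <= j)%N) (h' : (alpha i <= alpha j)%N),
    comp (mor_at Y h') (theta i) = comp (theta j) (mor_at X h).

Inductive GammaKind := IntN | IntNmp | IntNmmpp.

Definition ob_in (C : Category) (R : Reedy C) (G : GammaKind) n (X : chain C n) : Prop :=
  match G with
  | IntN => True
  | IntNmp => forall (i j : 'I_n.+1) (h : (i <= j)%N), minus R (mor_at X h)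
  | IntNmmpp => (forall (i j : 'I_n.+1) (h : (i <= j)%N), minus R (mor_at X h)) /\
                (forall (i j : 'I_n.+1) (h : (i <= j)%N), is_id (mor_at X h) -> i = j)
  end.

Definition mor_in (C : Category) (R : Reedy C) (G : GammaKind) m n
    (X : chain C m) (Y : chain C n) (p : pre_mor X Y) : Prop :=
  is_mor p /\
  match G with
  | IntN => True
  | IntNmp => forall i, plus R (projT2 p i)
  | IntNmmpp => (forall i, plus R (projT2 p i)) /\ injective (projT1 p)
  end.

Definition mor_le (C : Category) m n (X : chain C m) (Y : chain C n)
    (p q : pre_mor X Y) : Prop :=
  (forall i, (projT1 p i <= projT1 q i)%N) /\
  forall i (h : (projT1 p i <= projT1 q i)%N),
    projT2 q i = comp (mor_at Y h) (projT2 p i).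

Section Lattice.
Variables (T : Type) (S : T -> Prop) (le : T -> T -> Prop).
Definition is_meet x y z := S z /\ le z x /\ le z y /\
  forall w, S w -> le w x -> le w y -> le w z.
Definition is_join x y z := S z /\ le x z /\ le y z /\
  forall w, S w -> le x w -> le y w -> le z w.
Definition is_bounded_distributive_lattice : Prop :=
  [/\ (forall x, S x -> le x x),
      (forall x y, S x -> S y -> le x y -> le y x -> x = y),
      (forall x y z, S x -> S y -> S z -> le x y -> le y z -> le x z),
      ((exists b, S b /\ forall x, S x -> le b x) /\
       (exists t, S t /\ forall x, S x -> le x t)) /\
      (forall x y, S x -> S y -> (exists z, is_meet x y z) /\ (exists z, is_join x y z))
    & (forall x y z a b c d e, S x -> S y -> S z ->
        is_join y z a -> is_meet x a b -> is_meet x y c -> is_meet x z d ->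
        is_join c d e -> b = e)].
End Lattice.

(* Main.v *)
(* A morphism above (α, θ) is determined by its first component β, since
   θ is then forced to be Y(α ≤ β) ∘ θ.  The admissible β (order preserving,
   pointwise above α, and in the smaller Γ with components in C_+, resp.
   injective) are closed under pointwise min and max, which are therefore the
   meet and the join; distributivity is that of min and max on ℕ.  The bottom
   is (α, θ) itself, and a top exists because there are finitely many β and
   the join of two of them is again admissible. *)

Require Import Defs.
From mathcomp Require Import all_boot zify.
From Stdlib Require Import FunctionalExtensionality Classical.
Set Implicit Arguments. Unset Strict Implicit.

Section LatticeUniqueness.
Variables (T : Type) (S : T -> Prop) (le : T -> T -> Prop).
Hypothesis le_anti : forall x y, le x y -> le y x -> x = y.

Lemma is_meet_uniq x y z z' : is_meet S le x y z -> is_meet S le x y z' -> z = z'.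
Proof. by move=> [Sz [zx [zy zmax]]] [Sz' [z'x [z'y z'max]]]; apply: le_anti; auto. Qed.

Lemma is_join_uniq x y z z' : is_join S le x y z -> is_join S le x y z' -> z = z'.
Proof. by move=> [Sz [xz [yz zmin]]] [Sz' [xz' [yz' z'min]]]; apply: le_anti; auto. Qed.

End LatticeUniqueness.

Section OrdinalFunctions.
Variables m n : nat.
Implicit Types f g : 'I_m.+1 -> 'I_n.+1.

Definition minf f g i := if f i <= g i then f i else g i.
Definition maxf f g i := if f i <= g i then g i else f i.

Lemma minfE f g i : minf f g i = minn (f i) (g i) :> nat.
Proof. by rewrite /minf; case: leqP; lia. Qed.

Lemma maxfE f g i : maxf f g i = maxn (f i) (g i) :> nat.
Proof. by rewrite /maxf; case: leqP; lia. Qed.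

Lemma homo_leq_minf f g :
  {homo f : i j / i <= j} -> {homo g : i j / i <= j} -> {homo minf f g : i j / i <= j}.
Proof. by move=> hf hg i j /[dup] /hf + /hg; rewrite !minfE; lia. Qed.

Lemma homo_leq_maxf f g :
  {homo f : i j / i <= j} -> {homo g : i j / i <= j} -> {homo maxf f g : i j / i <= j}.
Proof. by move=> hf hg i j /[dup] /hf + /hg; rewrite !maxfE; lia. Qed.

Lemma homo_ltn_minf f g :
  {homo f : i j / i < j} -> {homo g : i j / i < j} -> {homo minf f g : i j / i < j}.
Proof. by move=> hf hg i j /[dup] /hf + /hg; rewrite !minfE; lia. Qed.

Lemma homo_ltn_maxf f g :
  {homo f : i j / i < j} -> {homo g : i j / i < j} -> {homo maxf f g : i j / i < j}.
Proof. by move=> hf hg i j /[dup] /hf + /hg; rewrite !maxfE; lia. Qed.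

Lemma inj_homo_ltn_ord f :
  injective f -> {homo f : i j / i <= j} -> {homo f : i j / i < j}.
Proof.
move=> f_inj f_mono i j lt_ij; rewrite ltn_neqAle f_mono ?(ltnW lt_ij) // andbT.
by apply: contraTneq lt_ij => /ord_inj /f_inj ->; rewrite ltnn.
Qed.

Lemma homo_ltn_inj_ord f : {homo f : i j / i < j} -> injective f.
Proof.
move=> f_strict i j fij; apply: ord_inj.
by case: (ltngtP i j) => // /f_strict; rewrite fij ltnn.
Qed.

Lemma ex_greatest_maxf (P : ('I_m.+1 -> 'I_n.+1) -> Prop) f0 :
  P f0 -> (forall f g, P f -> P g -> P (maxf f g)) ->
  exists2 t, P t & forall f, P f -> forall i, f i <= t i.
Proof.
move=> Pf0 Pmax.
pose weight f := \sum_(i < m.+1) (f i : nat).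
have weight_le f : weight f <= m.+1 * n.
  rewrite -[m.+1]card_ord -sum_nat_const; apply: leq_sum => i _.
  by rewrite -ltnS.
have weight_maxf f g i : f i < g i -> weight f < weight (maxf f g).
  move=> lt_fg; rewrite /weight (bigD1 i) // [X in _ < X](bigD1 i) //= -addSn.
  apply: leq_add; first by rewrite maxfE leq_max lt_fg orbT.
  by apply: leq_sum => j _; rewrite maxfE leq_maxl.
suff top d f : m.+1 * n - weight f = d -> P f ->
    exists2 t, P t & forall g, P g -> forall i, g i <= t i.
  exact: top _ f0 erefl Pf0.
elim/ltn_ind: d f => d IH f ed Pf; subst d.
have [[g Pg [i lt_fg]] | f_top] := classic (exists2 g, P g & exists i, f i < g i).
  apply: (IH _ _ (maxf f g) erefl (Pmax _ _ Pf Pg)).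
  by have := weight_maxf _ _ _ lt_fg; have := weight_le (maxf f g); lia.
exists f => // g Pg i; rewrite leqNgt; apply/negP => lt_fg.
by apply: f_top; exists g => //; exists i.
Qed.

End OrdinalFunctions.

Section HomOrder.
Variables (C : Category) (m n : nat) (X : chain C m) (Y : chain C n).
Implicit Types p q : pre_mor X Y.

Lemma mor_le_refl q : mor_le q q.
Proof. by split=> // i h; rewrite mor_at_id comp_id_l. Qed.

Lemma mor_le_trans q1 q2 q3 : mor_le q1 q2 -> mor_le q2 q3 -> mor_le q1 q3.
Proof.
move=> [le12 th12] [le23 th23]; split=> [i|i h]; first exact: leq_trans (le12 i) (le23 i).
by rewrite (th23 i (le23 i)) (th12 i (le12 i)) comp_assoc -(mor_at_comp _ _ _ h).
Qed.

Lemma mor_le_anti q1 q2 : mor_le q1 q2 -> mor_le q2 q1 -> q1 = q2.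
Proof.
case: q1 q2 => [a1 th1] [a2 th2] [/= le12 th12] [/= le21 _].
have ea : a1 = a2.
  by apply: functional_extensionality => i; apply/val_inj/eqP; rewrite eqn_leq le12 le21.
subst a2; congr existT; apply: functional_extensionality_dep => i.
by rewrite (th12 i (leqnn _)) mor_at_id comp_id_l.
Qed.

Lemma above_mor_le p q1 q2 : mor_le p q1 -> mor_le p q2 ->
  (forall i, projT1 q1 i <= projT1 q2 i) -> mor_le q1 q2.
Proof.
move=> [le1 th1] [le2 th2] le12; split=> // i h.
by rewrite (th2 i (le2 i)) (th1 i (le1 i)) comp_assoc -(mor_at_comp _ _ _ (le2 i)).
Qed.

Lemma above_eq p q1 q2 : mor_le p q1 -> mor_le p q2 ->
  (forall i, projT1 q1 i = projT1 q2 i :> nat) -> q1 = q2.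
Proof.
move=> pq1 pq2 e; apply: mor_le_anti; apply: above_mor_le; eauto => i; by rewrite e.
Qed.

Definition mor_above p (f : 'I_m.+1 -> 'I_n.+1) (ge_f : forall i, projT1 p i <= f i)
    : pre_mor X Y :=
  existT _ f (fun i => Defs.comp (mor_at Y (ge_f i)) (projT2 p i)).

Lemma mor_above_ge p f ge_f : mor_le p (@mor_above p f ge_f).
Proof. by split=> //= i h; rewrite (bool_irrelevance h (ge_f i)). Qed.

End HomOrder.

Section Interval.
Variables (C : Category) (R : Reedy C) (G : GammaKind) (m n : nat).
Variables (X : chain C m) (Y : chain C n) (p : pre_mor X Y).
Hypothesis p_in : mor_in R G p.
Implicit Types (f g : 'I_m.+1 -> 'I_n.+1) (q x y z : pre_mor X Y).

Local Notation interval := (fun q : pre_mor X Y => mor_in R G q /\ mor_le p q).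

Definition plus_above f :=
  forall i (h : projT1 p i <= f i), Defs.plus R (Defs.comp (mor_at Y h) (projT2 p i)).

(* For the third Γ, injectivity is replaced by the equivalent strict monotonicity,
   which is visibly preserved by min and max. *)
Definition admissible f : Prop :=
  [/\ {homo f : i j / i <= j}, forall i, projT1 p i <= f i &
      match G with
      | IntN => True
      | IntNmp => plus_above f
      | IntNmmpp => plus_above f /\ {homo f : i j / i < j}
      end].

Lemma admissible_interval q : interval q -> admissible (projT1 q).
Proof.
case=> [[[q_mono _] q_in] [ge_q th_q]].
have q_plus : (forall i, Defs.plus R (projT2 q i)) -> plus_above (projT1 q).
  by move=> q_plus i h; rewrite -th_q.
split=> //; case: G q_in => [// | /q_plus // | [/q_plus q_plus' q_inj]].
by split; last exact: inj_homo_ltn_ord.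
Qed.

Lemma interval_mor_above f ge_f : admissible f -> interval (@mor_above _ _ _ X Y p f ge_f).
Proof.
case: p_in => [[p_mono p_nat] _] [f_mono _ f_in]; split; last exact: mor_above_ge.
split.
  split=> //= i j h h'.
  rewrite comp_assoc -(mor_at_comp _ _ _ (leq_trans (ge_f i) h')).
  rewrite -comp_assoc -(p_nat i j h (p_mono _ _ h)) comp_assoc.
  rewrite -(mor_at_comp _ _ _ (leq_trans (p_mono _ _ h) (ge_f j))).
  by rewrite (bool_irrelevance (leq_trans (p_mono _ _ h) (ge_f j)) (leq_trans (ge_f i) h')).
case: G f_in => [// | f_plus i | [f_plus f_strict]]; first exact: f_plus.
by split; [move=> i; exact: f_plus | exact: homo_ltn_inj_ord].
Qed.

Lemma admissible_minf f g : admissible f -> admissible g -> admissible (minf f g).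
Proof.
have plus_minf : plus_above f -> plus_above g -> plus_above (minf f g).
  by move=> pf pg i; rewrite /minf; case: ifP => _ h; [apply: pf | apply: pg].
case=> [f_mono ge_f f_in] [g_mono ge_g g_in]; split.
- exact: homo_leq_minf.
- by move=> i; rewrite minfE leq_min ge_f ge_g.
- case: G f_in g_in => [// | pf pg | [pf sf] [pg sg]]; first exact: plus_minf.
  by split; [exact: plus_minf | exact: homo_ltn_minf].
Qed.

Lemma admissible_maxf f g : admissible f -> admissible g -> admissible (maxf f g).
Proof.
have plus_maxf : plus_above f -> plus_above g -> plus_above (maxf f g).
  by move=> pf pg i; rewrite /maxf; case: ifP => _ h; [apply: pg | apply: pf].
case=> [f_mono ge_f f_in] [g_mono ge_g g_in]; split.
- exact: homo_leq_maxf.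
- by move=> i; rewrite maxfE (leq_trans (ge_f i)) ?leq_maxl.
- case: G f_in g_in => [// | pf pg | [pf sf] [pg sg]]; first exact: plus_maxf.
  by split; [exact: plus_maxf | exact: homo_ltn_maxf].
Qed.

Lemma ex_meet_minf x y : interval x -> interval y ->
  exists2 z, is_meet interval (@mor_le C m n X Y) x y z &
             forall i, projT1 z i = minn (projT1 x i) (projT1 y i) :> nat.
Proof.
move=> Sx Sy.
have adm_z := admissible_minf (admissible_interval Sx) (admissible_interval Sy).
have [_ ge_z _] := adm_z; have Sz := interval_mor_above ge_z adm_z.
exists (mor_above ge_z) => [|i]; last exact: minfE.
split=> //; split; first by apply: (above_mor_le Sz.2 Sx.2) => i /=; rewrite minfE geq_minl.
split; first by apply: (above_mor_le Sz.2 Sy.2) => i /=; rewrite minfE geq_minr.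
move=> w Sw [wx _] [wy _]; apply: (above_mor_le Sw.2 Sz.2) => i /=.
by rewrite minfE leq_min wx wy.
Qed.

Lemma ex_join_maxf x y : interval x -> interval y ->
  exists2 z, is_join interval (@mor_le C m n X Y) x y z &
             forall i, projT1 z i = maxn (projT1 x i) (projT1 y i) :> nat.
Proof.
move=> Sx Sy.
have adm_z := admissible_maxf (admissible_interval Sx) (admissible_interval Sy).
have [_ ge_z _] := adm_z; have Sz := interval_mor_above ge_z adm_z.
exists (mor_above ge_z) => [|i]; last exact: maxfE.
split=> //; split; first by apply: (above_mor_le Sx.2 Sz.2) => i /=; rewrite maxfE leq_maxl.
split; first by apply: (above_mor_le Sy.2 Sz.2) => i /=; rewrite maxfE leq_maxr.
move=> w Sw [xw _] [yw _]; apply: (above_mor_le Sz.2 Sw.2) => i /=.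
by rewrite maxfE geq_max xw yw.
Qed.

Lemma is_meet_minn x y z : interval x -> interval y ->
  is_meet interval (@mor_le C m n X Y) x y z ->
  forall i, projT1 z i = minn (projT1 x i) (projT1 y i) :> nat.
Proof.
move=> Sx Sy xyz; have [z' xyz' z'E] := ex_meet_minf Sx Sy.
by rewrite (is_meet_uniq (@mor_le_anti C m n X Y) xyz xyz').
Qed.

Lemma is_join_maxn x y z : interval x -> interval y ->
  is_join interval (@mor_le C m n X Y) x y z ->
  forall i, projT1 z i = maxn (projT1 x i) (projT1 y i) :> nat.
Proof.
move=> Sx Sy xyz; have [z' xyz' z'E] := ex_join_maxf Sx Sy.
by rewrite (is_join_uniq (@mor_le_anti C m n X Y) xyz xyz').
Qed.

Lemma interval_bottom : interval p.
Proof. by split; last exact: mor_le_refl. Qed.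

Lemma ex_interval_top : exists2 t, interval t & forall x, interval x -> mor_le x t.
Proof.
have [f f_adm f_top] := ex_greatest_maxf (admissible_interval interval_bottom) admissible_maxf.
have [_ ge_f _] := f_adm.
have St := interval_mor_above ge_f f_adm.
exists (mor_above ge_f) => // x Sx.
exact: (above_mor_le Sx.2 St.2) (f_top _ (admissible_interval Sx)).
Qed.

End Interval.

Theorem corollary4p5 (C : Category) (R : Reedy C) (G : GammaKind) (m n : nat)
    (X : chain C m) (Y : chain C n) (p : pre_mor X Y) :
  ob_in R G X -> ob_in R G Y -> mor_in R G p ->
  is_bounded_distributive_lattice
    (fun q : pre_mor X Y => mor_in R G q /\ mor_le p q) (@mor_le C m n X Y).
Proof.
move=> _ _ p_in; split.
- by move=> x _; exact: mor_le_refl.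
- by move=> x y _ _; exact: mor_le_anti.
- by move=> x y z _ _ _; exact: mor_le_trans.
- split; first split.
  + by exists p; split=> [|x []]; first exact: interval_bottom.
  + by have [t St t_top] := ex_interval_top p_in; exists t.
  + move=> x y Sx Sy; split.
      by have [z] := ex_meet_minf p_in Sx Sy; exists z.
    by have [z] := ex_join_maxf p_in Sx Sy; exists z.
- move=> x y z a b c d e Sx Sy Sz yza xab xyc xzd cde.
  apply: (above_eq xab.1.2 cde.1.2) => i.
  rewrite (is_meet_minn p_in Sx yza.1 xab) (is_join_maxn p_in xyc.1 xzd.1 cde).
  rewrite (is_join_maxn p_in Sy Sz yza).
  by rewrite (is_meet_minn p_in Sx Sy xyc) (is_meet_minn p_in Sx Sz xzd) minn_maxr.
Qed.
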